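(* Define integers $A''(n)$, $n\ge1$, by \[ \sum_{n=1}^\infty A''(n) q^n := \sum_{n=1}^\infty q^{n}(-q^{n+1};q)_\infty^2 (q^{n+1};q)_\infty (q^{n};q)_{n}. \] Then \[ \sum_{n=1}^\infty q^{n}(-q^{n+1};q)_\infty^2 (q^{n+1};q)_\infty (q^{n};q)_{n} = \sum_{n=1}^\infty n\, q^{\frac{n(n+1)}{2}}. \]
   Context: Here $q$ is a complex number with $|q|<1$ (equivalently, identities of formal power series in $q$). Notation: $(a;q)_0=1$, $(a;q)_n=\prod_{j=0}^{n-1}(1-aq^j)$, $(a;q)_\infty=\prod_{j=0}^{\infty}(1-aq^j)$, and $(a;q)_\infty^k$ denotes the $k$-th power of $(a;q)_\infty$. *)

(* Defs.v *)
From Stdlib Require Export Reals ZArith.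
From Coquelicot Require Export Coquelicot.
Open Scope C_scope.

Fixpoint qpoch (a q : C) (n : nat) : C :=
  match n with
  | O => 1
  | S m => qpoch a q m * (1 - a * q ^ m)
  end.

(* [lim] is total; by [complete_cauchy] its value is the limit as soon as the
   partial products converge, which they do for all [a] when [Cmod q < 1]. *)
Definition qpoch_inf (a q : C) : C :=
  lim (T := CompleteNormedModule.CompleteSpace C_AbsRing C_CompleteNormedModule)
    (filtermap (qpoch a q) eventually).

Definition is_series1 (a : nat -> C) (l : C) : Prop :=
  is_series (fun k : nat => a (S k)) l.

Definition summand (q : C) (n : nat) : C :=
  q ^ n * qpoch_inf (- q ^ (n + 1)) q ^ 2
    * qpoch_inf (q ^ (n + 1)) q * qpoch (q ^ n) q n.

(* Only the values [A n] with [1 <= n] are constrained. *)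
Definition has_gf (A : nat -> Z) : Prop :=
  forall q : C, (Cmod q < 1)%R ->
    exists s : C,
      is_series1 (fun n : nat => RtoC (IZR (A n)) * q ^ n) s /\
      is_series1 (summand q) s.

(* Main.v *)
Require Import Defs.
From Stdlib Require Import Lra Lia.

(** Put [c_n(w) = (w q; q^2)_n / (w q^2; q^2)_n], [Phi(w,t) = sum c_n(w) t^n],
    [psi = Phi(1,q)] and [Gam(z) = sum q^n c_n(1) / (1 + z q^n)].  The n-th
    summand is [psi q^n c_n(1) / (1 + q^n)], so the left-hand side is
    [psi (Gam(1) - 1/2)].  Three functional equations, each with a telescoping
    certificate, give

    - [lim c_n(w) = 1 / Phi(1, w q)], hence [psi = (q;q)_oo (-q;q)_oo^2];
    - [Phi(w, w q) = sum w^n q^(n(n+1)/2)], a case of the Rogers-Fine identity;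
    - [(1 - w) psi Gam(z) = psi^2 / Phi(1, w q) - z Phi(w, q)] where [w = z^2].

    Writing every [Phi] in the third formula as [psi] minus a multiple of
    [1 - w], dividing by [1 - w] and letting [z -> 1] gives the theorem: the two
    limits of the form [sum n c_n(1) q^n] cancel, and the derivative of the theta
    series of the second formula, [sum n q^(n(n+1)/2)], remains. *)

(** * Limits, dominated series and products of complex numbers *)

Definition Clim (u : nat -> C) (l : C) : Prop :=
  filterlim u eventually (locally l).

Lemma Clim_spec (u : nat -> C) (l : C) :
  Clim u l <-> is_lim_seq (fun n => Cmod (u n - l)) 0%R.
Proof.
  split; intro H.
  - apply is_lim_seq_spec; intro eps.
    pose proof (proj1 (filterlim_locally_ball_norm (F := eventually) u l) H eps) as [N HN].
    exists N; intros n Hn; specialize (HN n Hn).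
    rewrite Rminus_0_r, Rabs_pos_eq by apply Cmod_ge_0. exact HN.
  - apply (proj2 (filterlim_locally_ball_norm (F := eventually) u l)); intro eps.
    destruct (proj2 (is_lim_seq_spec _ _) H eps) as [N HN].
    exists N; intros n Hn; specialize (HN n Hn).
    rewrite Rminus_0_r, Rabs_pos_eq in HN by apply Cmod_ge_0. exact HN.
Qed.

Lemma Clim_le (u : nat -> C) (l : C) (b : nat -> R) :
  (forall n, (Cmod (u n - l) <= b n)%R) -> is_lim_seq b 0%R -> Clim u l.
Proof.
  intros Hb Lb. apply Clim_spec.
  apply is_lim_seq_le_le with (u := fun _ => 0%R) (w := b); auto.
  - intro n; split; [apply Cmod_ge_0 | apply Hb].
  - apply is_lim_seq_const.
Qed.

Lemma Clim_ext (u v : nat -> C) (l : C) :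
  (forall n, u n = v n) -> Clim u l -> Clim v l.
Proof. intros E; apply filterlim_ext; exact E. Qed.

Lemma Clim_const (l : C) : Clim (fun _ => l) l.
Proof. apply filterlim_const. Qed.

Lemma Clim_unique (u : nat -> C) (l l' : C) : Clim u l -> Clim u l' -> l = l'.
Proof. apply (filterlim_locally_unique (V := C_NormedModule) (F := eventually)). Qed.

Lemma Clim_plus (u v : nat -> C) (l m : C) :
  Clim u l -> Clim v m -> Clim (fun n => u n + v n) (l + m).
Proof.
  intros Hu Hv.
  exact (filterlim_comp_2 (F := eventually) u v Cplus Hu Hv
    (filterlim_plus (V := C_NormedModule) l m)).
Qed.

Lemma Clim_mult (u v : nat -> C) (l m : C) :
  Clim u l -> Clim v m -> Clim (fun n => u n * v n) (l * m).
Proof.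
  intros Hu Hv. apply Clim_spec in Hu, Hv.
  apply Clim_le with (b := fun n => (Cmod (u n - l) * Cmod (v n - m)
    + Cmod l * Cmod (v n - m) + Cmod (u n - l) * Cmod m)%R).
  - intro n. rewrite <- !Cmod_mult.
    replace (u n * v n - l * m)
      with ((u n - l) * (v n - m) + l * (v n - m) + (u n - l) * m) by ring.
    eapply Rle_trans; [apply Cmod_triangle|].
    apply Rplus_le_compat_r, Cmod_triangle.
  - replace 0%R with (0 * 0 + Cmod l * 0 + 0 * Cmod m)%R by ring.
    apply is_lim_seq_plus'; [apply is_lim_seq_plus'|];
      apply is_lim_seq_mult'; auto; apply is_lim_seq_const.
Qed.

Lemma Clim_opp (u : nat -> C) (l : C) : Clim u l -> Clim (fun n => - u n) (- l).
Proof.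
  intros Hu. exact (filterlim_comp _ _ _ u Copp _ _ _ Hu (filterlim_opp (V := C_NormedModule) l)).
Qed.

Lemma Clim_minus (u v : nat -> C) (l m : C) :
  Clim u l -> Clim v m -> Clim (fun n => u n - v n) (l - m).
Proof. intros Hu Hv; apply Clim_plus; [ | apply Clim_opp]; assumption. Qed.

Lemma Clim_pow (u : nat -> C) (l : C) (k : nat) :
  Clim u l -> Clim (fun n => u n ^ k) (l ^ k).
Proof.
  intro H; induction k as [|k IH]; [apply Clim_const | apply Clim_mult; assumption].
Qed.

Lemma Clim_subseq (u : nat -> C) (l : C) (phi : nat -> nat) :
  (forall n, (n <= phi n)%nat) -> Clim u l -> Clim (fun n => u (phi n)) l.
Proof.
  intros Hphi H. apply filterlim_comp with (2 := H).
  intros P [N HN]; exists N; intros n Hn; apply HN.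
  apply Nat.le_trans with n; auto.
Qed.

Lemma Clim_incr (u : nat -> C) (l : C) :
  Clim (fun n => u (S n)) l <-> Clim u l.
Proof.
  rewrite !Clim_spec.
  symmetry; apply (is_lim_seq_incr_1 (fun n => Cmod (u n - l))).
Qed.

Lemma Cmod_minus_sym (x y : C) : Cmod (x - y) = Cmod (y - x).
Proof. rewrite <- Cmod_opp. f_equal; ring. Qed.

Lemma Cmod_triangle_inv (x y : C) : (Cmod x - Cmod y <= Cmod (x - y))%R.
Proof.
  pose proof (Cmod_triangle (x - y) y) as H.
  replace (x - y + y) with x in H by ring. lra.
Qed.

Lemma Clim_Cmod (u : nat -> C) (l : C) :
  Clim u l -> is_lim_seq (fun n => Cmod (u n)) (Cmod l).
Proof.
  intro H. apply Clim_spec in H. apply is_lim_seq_spec; intro eps.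
  destruct (proj2 (is_lim_seq_spec _ _) H eps) as [N HN].
  exists N; intros n Hn; specialize (HN n Hn).
  rewrite Rminus_0_r, Rabs_pos_eq in HN by apply Cmod_ge_0.
  apply Rle_lt_trans with (2 := HN). apply Rabs_le.
  pose proof (Cmod_triangle_inv (u n) l).
  pose proof (Cmod_triangle_inv l (u n)) as H1. rewrite Cmod_minus_sym in H1. lra.
Qed.

Lemma Clim_Cmod_le (u : nat -> C) (l : C) (b : R) :
  (forall n, (Cmod (u n) <= b)%R) -> Clim u l -> (Cmod l <= b)%R.
Proof.
  intros Hb H.
  exact (is_lim_seq_le _ _ _ _ Hb (Clim_Cmod _ _ H) (is_lim_seq_const b)).
Qed.

Lemma Clim_inv (u : nat -> C) (l : C) (d : R) :
  (0 < d)%R -> (forall n, (d <= Cmod (u n))%R) -> Clim u l ->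
  Clim (fun n => / u n) (/ l).
Proof.
  intros Hd Hu H.
  assert (Hl : (d <= Cmod l)%R).
  { exact (is_lim_seq_le _ _ _ _ Hu (is_lim_seq_const d) (Clim_Cmod _ _ H)). }
  assert (nz : forall x, (d <= Cmod x)%R -> x <> 0).
  { intros x Hx ->. rewrite Cmod_0 in Hx; lra. }
  apply Clim_le with (b := fun n => (/ (d * d) * Cmod (u n - l))%R).
  - intro n. pose proof (nz _ (Hu n)); pose proof (nz _ Hl).
    replace (/ u n - / l) with (/ (u n * l) * (l - u n)) by (field; auto).
    rewrite Cmod_mult, (Cmod_minus_sym l).
    apply Rmult_le_compat_r; [apply Cmod_ge_0|].
    rewrite Cmod_inv, Cmod_mult by (apply Cmult_neq_0; auto).
    apply Rinv_le_contravar; [nra|].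
    apply Rmult_le_compat; auto; lra.
  - apply Clim_spec in H.
    replace 0%R with (/ (d * d) * 0)%R by ring.
    apply (is_lim_seq_scal_l _ (/ (d * d))%R 0%R H).
Qed.

(* [qpoch_inf a q] is convertible to [Climit (qpoch a q)]. *)
Definition Climit (u : nat -> C) : C :=
  lim (T := CompleteNormedModule.CompleteSpace C_AbsRing C_CompleteNormedModule)
    (filtermap u eventually).

(** A convergent sequence generates a Cauchy filter, so [complete_cauchy] applies, and uniqueness of
    limits identifies the value. *)
Lemma Climit_correct (u : nat -> C) (l : C) : Clim u l -> Climit u = l.
Proof.
  intro H. symmetry. apply (Clim_unique u _ _ H).
  apply filterlim_locally. intro eps.
  apply (complete_cauchy
    (T := CompleteNormedModule.CompleteSpace C_AbsRing C_CompleteNormedModule)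
    (filtermap u eventually)).
  - apply filtermap_proper_filter, eventually_filter.
  - intro e. exists l. exact (proj1 (filterlim_locally (F := eventually) u l) H e).
Qed.

(** * Series with explicit majorants *)

Definition CSeries (a : nat -> C) : C := Climit (sum_n a).

Lemma is_CSeries_unique (a : nat -> C) (s : C) : is_series a s -> CSeries a = s.
Proof. apply Climit_correct. Qed.

Lemma CSeries_ext (a b : nat -> C) : (forall n, a n = b n) -> CSeries a = CSeries b.
Proof.
  intro E. unfold CSeries. f_equal.
  apply FunctionalExtensionality.functional_extensionality; intro n.
  apply sum_n_ext, E.
Qed.

(** The majorant stays explicit because tail bounds and passages to the limit need one that is
    uniform in a parameter. *)
Definition dominated (a : nat -> C) (b : nat -> R) : Prop :=
  ex_series b /\ forall n, (Cmod (a n) <= b n)%R.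

Lemma CSeries_correct (a : nat -> C) (b : nat -> R) :
  dominated a b -> is_series a (CSeries a).
Proof.
  intros [Sb Hb].
  destruct (ex_series_le (K := C_AbsRing) (V := C_CompleteNormedModule) a b Hb Sb) as [s Hs].
  change (is_series (V := C_NormedModule) a s) in Hs.
  rewrite (is_CSeries_unique _ _ Hs). exact Hs.
Qed.

Lemma sum_n_Cmod_le (a : nat -> C) (b : nat -> R) (N k : nat) :
  (forall n, (Cmod (a n) <= b n)%R) ->
  (Cmod (sum_n a (k + N) - sum_n a N) <= sum_n b (k + N) - sum_n b N)%R.
Proof.
  intro Hb. induction k as [|k IH]; simpl.
  - unfold Cminus. rewrite Cplus_opp_r, Cmod_0. lra.
  - rewrite !sum_Sn. unfold plus; simpl.
    replace (sum_n a (k + N) + a (S (k + N)) - sum_n a N)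
      with ((sum_n a (k + N) - sum_n a N) + a (S (k + N))) by ring.
    eapply Rle_trans; [apply Cmod_triangle|].
    specialize (Hb (S (k + N))). lra.
Qed.

Lemma CSeries_tail (a : nat -> C) (b : nat -> R) (N : nat) :
  dominated a b -> (Cmod (CSeries a - sum_n a N) <= Series b - sum_n b N)%R.
Proof.
  intro D. pose proof (CSeries_correct _ _ D) as Ha. destruct D as [Sb Hb].
  refine (is_lim_seq_le (fun k => Cmod (sum_n a (k + N) - sum_n a N))
    (fun k => sum_n b (k + N) - sum_n b N)%R (Cmod (CSeries a - sum_n a N))
    (Series b - sum_n b N)%R (fun k => sum_n_Cmod_le a b N k Hb) _ _).
  - apply (Clim_Cmod (fun k => sum_n a (k + N) - sum_n a N)), Clim_minus; [|apply Clim_const].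
    apply (Clim_subseq (sum_n a) _ (fun k => k + N)%nat); [intro; lia | exact Ha].
  - apply is_lim_seq_minus'; [|apply is_lim_seq_const].
    apply (is_lim_seq_incr_n (sum_n b) N).
    exact (Series_correct _ Sb).
Qed.

Lemma Clim_sum_n (a : nat -> nat -> C) (b : nat -> C) (N : nat) :
  (forall k, Clim (fun j => a j k) (b k)) ->
  Clim (fun j => sum_n (a j) N) (sum_n b N).
Proof.
  intro H. induction N as [|N IH].
  - rewrite sum_O. apply Clim_ext with (2 := H O). intro; now rewrite sum_O.
  - rewrite sum_Sn. apply Clim_ext with (2 := Clim_plus _ _ _ _ IH (H (S N))).
    intro; now rewrite sum_Sn.
Qed.

(** Tannery's theorem, dominated convergence for series: beyond a cut-off [N] both tails are
    controlled by the tail of [M], and the finitely many remaining terms converge one by one. *)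
Lemma tannery (a : nat -> nat -> C) (b : nat -> C) (M : nat -> R) :
  (forall j, dominated (a j) M) -> (forall k, Clim (fun j => a j k) (b k)) ->
  Clim (fun j => CSeries (a j)) (CSeries b).
Proof.
  intros D H.
  assert (Db : dominated b M).
  { split; [exact (proj1 (D O))|]. intro k.
    apply Clim_Cmod_le with (2 := H k). intro j; apply (proj2 (D j)). }
  apply Clim_spec, is_lim_seq_spec; intro eps.
  (* Two tails and one difference of finite sums, each at most [eps / 4], stay below [eps]. *)
  assert (He : (0 < eps / 4)%R) by (destruct eps; simpl; lra).
  pose proof (Series_correct _ (proj1 Db)) as HM.
  destruct (proj2 (is_lim_seq_spec (sum_n M) (Series M)) HM (mkposreal _ He)) as [N HN].
  specialize (HN N (le_n N)). simpl in HN.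
  pose proof (Clim_sum_n a b N H) as HS. apply Clim_spec in HS.
  destruct (proj2 (is_lim_seq_spec _ _) HS (mkposreal _ He)) as [J HJ].
  exists J; intros j Hj. specialize (HJ j Hj). simpl in HJ.
  rewrite Rminus_0_r, Rabs_pos_eq in * by apply Cmod_ge_0.
  pose proof (CSeries_tail _ _ N (D j)) as T1.
  pose proof (CSeries_tail _ _ N Db) as T2.
  rewrite Cmod_minus_sym in T2.
  apply Rabs_def2 in HN.
  replace (CSeries (a j) - CSeries b) with
    ((CSeries (a j) - sum_n (a j) N) + (sum_n (a j) N - sum_n b N)
      + (sum_n b N - CSeries b)) by ring.
  eapply Rle_lt_trans; [apply Cmod_triangle|].
  pose proof (Cmod_triangle (CSeries (a j) - sum_n (a j) N) (sum_n (a j) N - sum_n b N)).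
  lra.
Qed.

(** The three functional equations are all proved through this lemma, with [g] an explicit
    certificate for the summands. *)
Lemma is_series_telescope (a g : nat -> C) (s l : C) :
  (forall n, a n = g (S n) - g n) -> Clim g l -> s = l - g O -> is_series a s.
Proof.
  intros E Hg ->. change (Clim (sum_n a) (l - g O)).
  apply Clim_ext with (u := fun n => g (S n) - g O).
  - induction n as [|n IH]; [rewrite sum_O; now rewrite E|].
    rewrite sum_Sn, <- IH, E. unfold plus; simpl. ring.
  - apply Clim_minus; [apply Clim_incr, Hg | apply Clim_const].
Qed.

Lemma CSeries_lin (x y : C) (a b : nat -> C) (A B : nat -> R) :
  dominated a A -> dominated b B ->
  is_series (fun n => x * a n + y * b n) (x * CSeries a + y * CSeries b).
Proof.
  intros Ha Hb.
  apply (is_series_plus (V := C_NormedModule) (fun n => x * a n) (fun n => y * b n));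
  apply (is_series_scal (V := C_NormedModule)); eapply CSeries_correct; eassumption.
Qed.

Lemma is_series_tail (a : nat -> C) (s : C) :
  is_series a s -> is_series (fun k => a (S k)) (s - a O).
Proof.
  intro H. apply (is_series_incr_1 (V := C_NormedModule) a).
  change (is_series a (s - a O + a O)).
  replace (s - a O + a O) with s by ring. exact H.
Qed.

(** Equalities left by [is_series_ext] live in the carrier of a normed module; restating them in [C]
    makes [ring] applicable. *)
Ltac ceq := match goal with |- @eq _ ?a ?b => change (@eq C a b) end.

(** * Infinite products whose factors approach 1 geometrically *)

Fixpoint cprod (u : nat -> C) (n : nat) : C :=
  match n with
  | O => 1
  | S m => cprod u m * u m
  end.

(** Each factor satisfies [|u j| <= 1 + A r^j <= exp (A r^j)], and the exponents sum to at most
    [A / (1 - r)]. *)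
Lemma cprod_bound (u : nat -> C) (A r : R) (n : nat) :
  (0 < r < 1)%R -> (forall j, (Cmod (u j - 1) <= A * r ^ j)%R) ->
  (Cmod (cprod u n) <= exp (A / (1 - r)))%R.
Proof.
  intros Hr Hu.
  assert (HA : (0 <= A)%R).
  { pose proof (Hu O). pose proof (Cmod_ge_0 (u O - 1)). simpl in *. lra. }
  (* The induction runs on the exact geometric partial sum; the final bound, constant in [n], is not
     inductive. *)
  apply Rle_trans with (exp (A * ((1 - r ^ n) / (1 - r)))).
  - induction n as [|n IH]; simpl.
    + rewrite Cmod_1. replace (A * ((1 - 1) / (1 - r)))%R with 0%R by (field; lra).
      rewrite exp_0; lra.
    + rewrite Cmod_mult.
      replace (A * ((1 - r * r ^ n) / (1 - r)))%R
        with (A * ((1 - r ^ n) / (1 - r)) + A * r ^ n)%R by (field; lra).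
      rewrite exp_plus. apply Rmult_le_compat; try apply Cmod_ge_0; [exact IH|].
      apply Rle_trans with (2 := exp_ineq1_le _).
      pose proof (Cmod_triangle_inv (u n) 1) as H. rewrite Cmod_1 in H.
      specialize (Hu n). lra.
  - assert (0 < r ^ n)%R by (apply pow_lt; lra).
    assert (H1 : (A * ((1 - r ^ n) / (1 - r)) <= A / (1 - r))%R).
    { unfold Rdiv. apply Rmult_le_compat_l; [lra|].
      assert (0 < / (1 - r))%R by (apply Rinv_0_lt_compat; lra). nra. }
    destruct H1 as [H1| ->]; [left; now apply exp_increasing | lra].
Qed.

Lemma ex_series_geom_scal (A r : R) : (0 < r < 1)%R -> ex_series (fun n => A * r ^ n)%R.
Proof.
  intro Hr. apply (ex_series_scal (V := R_NormedModule)).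
  apply ex_series_geom. rewrite Rabs_pos_eq; lra.
Qed.

(** The partial products are 1 plus the partial sums of the increments [d n], which the uniform
    bound on products makes geometrically small. *)
Lemma cprod_cv (u : nat -> C) (A r : R) :
  (0 < r < 1)%R -> (forall j, (Cmod (u j - 1) <= A * r ^ j)%R) ->
  exists l, Clim (cprod u) l.
Proof.
  intros Hr Hu. set (d := fun n => cprod u n * (u n - 1)).
  assert (D : dominated d (fun n => exp (A / (1 - r)) * A * r ^ n)%R).
  { split; [now apply ex_series_geom_scal|]. intro n. unfold d.
    rewrite Cmod_mult, Rmult_assoc.
    apply Rmult_le_compat; try apply Cmod_ge_0; [now apply cprod_bound | apply Hu]. }
  exists (1 + CSeries d). apply Clim_incr.
  apply Clim_ext with (u := fun n => 1 + sum_n d n).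
  - induction n as [|n IH].
    + rewrite sum_O. unfold d; simpl. ring.
    + rewrite sum_Sn. change (1 + (sum_n d n + d (S n)) = cprod u (S (S n))).
      rewrite Cplus_assoc, IH. unfold d; simpl. ring.
  - apply Clim_plus; [apply Clim_const | exact (CSeries_correct _ _ D)].
Qed.

(** Ratio test, applied from index 1 because it requires nonzero terms and the term of index 0
    vanishes. *)
Lemma ex_series_INR_geom (r : R) : (0 < r < 1)%R -> ex_series (fun n => INR n * r ^ n)%R.
Proof.
  intro Hr.
  apply (ex_series_incr_1 (V := R_NormedModule) (fun n => INR n * r ^ n)%R).
  apply ex_series_ext with (fun n => Rabs (INR (S n) * r ^ S n)).
  { intro n. apply Rabs_pos_eq, Rmult_le_pos; [apply pos_INR | apply pow_le; lra]. }
  apply ex_series_DAlembert with (k := r); [lra| |].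
  - intro n. apply Rmult_integral_contrapositive; split;
      [apply not_0_INR; lia | apply pow_nonzero; lra].
  - apply is_lim_seq_ext with (fun n => (r + r * / INR (S n))%R).
    + intro n. rewrite (S_INR (S n)).
      assert (0 < INR (S n))%R by (apply lt_0_INR; lia).
      assert (r ^ n <> 0)%R by (apply pow_nonzero; lra).
      replace ((INR (S n) + 1) * r ^ S (S n) / (INR (S n) * r ^ S n))%R
        with (r + r * / INR (S n))%R by (simpl pow; field; repeat split; lra).
      symmetry; apply Rabs_pos_eq.
      assert (0 < / INR (S n))%R by now apply Rinv_0_lt_compat.
      nra.
    + replace (Finite r) with (Finite (r + r * 0)%R) by (f_equal; ring).
      apply is_lim_seq_plus'; [apply is_lim_seq_const|].
      apply (is_lim_seq_scal_l _ r 0%R).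
      apply (is_lim_seq_inv (fun n => INR (S n)) p_infty).
      * apply (is_lim_seq_incr_1 INR p_infty), is_lim_seq_INR.
      * discriminate.
Qed.

(** * The functional equations *)

Section QSeries.

Variables (q : C) (r : R).
Hypothesis r01 : (0 < r < 1)%R.
Hypothesis qr : (Cmod q <= r)%R.

Lemma r_pow_pos (n : nat) : (0 < r ^ n)%R.
Proof. apply pow_lt; lra. Qed.

Lemma Cmod_pow_le (t : C) (n : nat) : (Cmod t <= r)%R -> (Cmod (t ^ n) <= r ^ n)%R.
Proof.
  intro Ht. rewrite Cmod_pow. apply pow_incr. split; [apply Cmod_ge_0 | exact Ht].
Qed.

Lemma Cmod_mult_le (x y : C) (a b : R) :
  (Cmod x <= a)%R -> (Cmod y <= b)%R -> (Cmod (x * y) <= a * b)%R.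
Proof. intros Hx Hy. rewrite Cmod_mult. apply Rmult_le_compat; auto; apply Cmod_ge_0. Qed.

Lemma Cmod_mult_r (x y : C) : (Cmod x <= 1)%R -> (Cmod y <= r)%R -> (Cmod (x * y) <= r)%R.
Proof. intros. rewrite <- (Rmult_1_l r). now apply Cmod_mult_le. Qed.

Lemma r_pow_le_1 (n : nat) : (r ^ n <= 1)%R.
Proof. rewrite <- (pow1 n). apply pow_incr. lra. Qed.

Lemma r_pow_S_le (n : nat) : (r ^ S n <= r)%R.
Proof. pose proof (r_pow_le_1 n). pose proof (r_pow_pos n). simpl. nra. Qed.

Lemma Cmod_q_pow_le_1 (n : nat) : (Cmod (q ^ n) <= 1)%R.
Proof. eapply Rle_trans; [now apply Cmod_pow_le | apply r_pow_le_1]. Qed.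

Lemma Cmod_q_pow_S (n : nat) : (Cmod (q ^ S n) <= r)%R.
Proof. eapply Rle_trans; [now apply Cmod_pow_le | apply r_pow_S_le]. Qed.

Lemma one_minus_bound (x : C) : (Cmod x <= r)%R -> (1 - r <= Cmod (1 - x))%R.
Proof. intro H. pose proof (Cmod_triangle_inv 1 x) as H1. rewrite Cmod_1 in H1. lra. Qed.

Lemma one_minus_nz (x : C) : (Cmod x <= r)%R -> 1 - x <> 0.
Proof. intros H E. pose proof (one_minus_bound x H) as H1. rewrite E, Cmod_0 in H1. lra. Qed.

(** * The coefficients [c_n(w)] *)

Definition qcoef_factor (w : C) (j : nat) : C :=
  (1 - w * q ^ (2 * j + 1)) / (1 - w * q ^ (2 * j + 2)).

Definition qcoef (w : C) : nat -> C := cprod (qcoef_factor w).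

Lemma q_pow_double (n : nat) : q ^ (2 * n) = q ^ n * q ^ n.
Proof. rewrite <- Cpow_add_r. f_equal; lia. Qed.

Lemma wq_pow_le (w : C) (n : nat) : (Cmod w <= 1)%R -> (0 < n)%nat -> (Cmod (w * q ^ n) <= r)%R.
Proof. intros Hw Hn. destruct n; [lia|]. apply Cmod_mult_r; [exact Hw | apply Cmod_q_pow_S]. Qed.

Lemma qcoef_factor_den_nz (w : C) (j : nat) : (Cmod w <= 1)%R -> 1 - w * q ^ (2 * j + 2) <> 0.
Proof. intro Hw. apply one_minus_nz, wq_pow_le; [exact Hw | lia]. Qed.

(** The factor differs from 1 by [w q^(2j+1) (q - 1) / (1 - w q^(2j+2))]. Splitting [q^(2j+1)] as
    [q^(j+1) q^j] leaves one [q^j] for the decay; [|q - 1| <= 2] and the denominator is at least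
    [1 - r]. *)
Lemma qcoef_factor_bound (w : C) (j : nat) :
  (Cmod w <= 1)%R -> (Cmod (qcoef_factor w j - 1) <= 2 / (1 - r) * r ^ j)%R.
Proof.
  intro Hw. pose proof (qcoef_factor_den_nz w j Hw) as nz. unfold qcoef_factor.
  replace ((1 - w * q ^ (2 * j + 1)) / (1 - w * q ^ (2 * j + 2)) - 1)
    with ((w * q ^ (j + 1)) * q ^ j * (q - 1) * / (1 - w * q ^ (2 * j + 2))).
  - rewrite Cmod_mult, Cmod_inv by exact nz.
    replace (2 / (1 - r) * r ^ j)%R with ((1 * r ^ j * 2) * / (1 - r))%R by (field; lra).
    apply Rmult_le_compat; [apply Cmod_ge_0 | | |].
    + left; apply Rinv_0_lt_compat, Cmod_gt_0, nz.
    + repeat apply Cmod_mult_le.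
      * rewrite <- (Rmult_1_l 1). apply Cmod_mult_le; [exact Hw | apply Cmod_q_pow_le_1].
      * now apply Cmod_pow_le.
      * unfold Cminus. eapply Rle_trans; [apply Cmod_triangle|].
        rewrite Cmod_opp, Cmod_1. lra.
    + apply Rinv_le_contravar; [lra|].
      apply one_minus_bound, wq_pow_le; [exact Hw | lia].
  - replace (q ^ (2 * j + 1)) with (q ^ (j + 1) * q ^ j)
      by (rewrite <- Cpow_add_r; f_equal; lia).
    replace (q ^ (2 * j + 2)) with (q ^ (j + 1) * q ^ j * q) in *
      by (rewrite <- (Cpow_1_r q) at 3; rewrite <- !Cpow_add_r; f_equal; lia).
    field. exact nz.
Qed.

(** The bound of [cprod_bound] for [A = 2 / (1 - r)]. It is independent of [w], which is what
    [tannery] needs when [w] varies. *)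
Definition qcoef_max : R := exp (2 / (1 - r) / (1 - r)).

Lemma qcoef_bound (w : C) (n : nat) : (Cmod w <= 1)%R -> (Cmod (qcoef w n) <= qcoef_max)%R.
Proof. intro Hw. apply cprod_bound; [exact r01|]. intro j; now apply qcoef_factor_bound. Qed.

Lemma qcoef_S (w : C) (n : nat) :
  qcoef w (S n) = qcoef w n * ((1 - w * (q ^ n * q ^ n * q)) / (1 - w * (q ^ n * q ^ n * (q * q)))).
Proof.
  change (qcoef w (S n)) with (qcoef w n * qcoef_factor w n). unfold qcoef_factor. f_equal.
  rewrite !Cpow_add_r, q_pow_double, Cpow_1_r. simpl. now rewrite Cmult_1_r.
Qed.

Lemma qcoef_den_nz (w : C) (n : nat) : (Cmod w <= 1)%R -> 1 - w * (q ^ n * q ^ n * (q * q)) <> 0.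
Proof.
  intro Hw. pose proof (qcoef_factor_den_nz w n Hw) as H.
  rewrite !Cpow_add_r, q_pow_double in H. simpl in H. now rewrite Cmult_1_r in H.
Qed.

Lemma geom_lim0 (u : nat -> C) (A : R) :
  (forall n, (Cmod (u n) <= A * r ^ n)%R) -> Clim u 0.
Proof.
  intro H. apply Clim_le with (b := fun n => (A * r ^ n)%R).
  - intro n. replace (u n - 0) with (u n) by ring. apply H.
  - replace 0%R with (A * 0)%R by ring. apply (is_lim_seq_scal_l _ A 0%R).
    apply is_lim_seq_geom. rewrite Rabs_pos_eq; lra.
Qed.

(** * The series [Phi], its functional equation in [t], and the limit of [c_n(w)] *)

Definition Phi (w t : C) : C := CSeries (fun n => qcoef w n * t ^ n).

Lemma Phi_dom (w t : C) : (Cmod w <= 1)%R -> (Cmod t <= r)%R ->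
  dominated (fun n => qcoef w n * t ^ n) (fun n => qcoef_max * r ^ n)%R.
Proof.
  intros Hw Ht. split; [now apply ex_series_geom_scal|].
  intro n. apply Cmod_mult_le; [now apply qcoef_bound | now apply Cmod_pow_le].
Qed.

Lemma Cmod_1_le : (Cmod 1 <= 1)%R.
Proof. rewrite Cmod_1; lra. Qed.

Lemma Cmod_one_minus_le (x : C) : (Cmod x <= 1)%R -> (Cmod (1 - x) <= 2)%R.
Proof.
  intro H. unfold Cminus. eapply Rle_trans; [apply Cmod_triangle|].
  rewrite Cmod_opp, Cmod_1. lra.
Qed.

(** This is the recurrence [c_{n+1}(1) (1 - q^(2n+2)) = c_n(1) (1 - q^(2n+1))] read on the
    generating function. The certificate vanishes at index 0 through [1 - q^0 q^0] and tends to
    0. *)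
Lemma Phi_1_step (t : C) : (Cmod t <= r)%R ->
  (1 - t) * Phi 1 t = (1 - t * q) * Phi 1 (t * (q * q)).
Proof.
  intro Ht.
  assert (Ht2 : (Cmod (t * (q * q)) <= r)%R).
  { rewrite Cmult_comm. apply Cmod_mult_r; [|exact Ht].
    pose proof (Cmod_q_pow_le_1 2) as H; simpl in H. now rewrite Cmult_1_r in H. }
  apply Ceq_minus.
  replace ((1 - t) * Phi 1 t - (1 - t * q) * Phi 1 (t * (q * q)))
    with ((1 - t) * Phi 1 t + (- (1 - t * q)) * Phi 1 (t * (q * q))) by ring.
  pose proof (CSeries_lin (1 - t) (- (1 - t * q)) _ _ _ _
    (Phi_dom 1 t Cmod_1_le Ht) (Phi_dom 1 _ Cmod_1_le Ht2)) as H.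
  apply is_CSeries_unique in H. unfold Phi. rewrite <- H.
  apply is_CSeries_unique.
  apply is_series_telescope with (l := RtoC 0)
    (g := fun n => - (qcoef 1 n * t ^ n * (1 - q ^ n * q ^ n))).
  - intro n. rewrite qcoef_S. rewrite !Cpow_mult_l. simpl Cpow.
    pose proof (qcoef_den_nz 1 n Cmod_1_le) as nz. field.
    intro E; apply nz; rewrite <- E; ring.
  - apply geom_lim0 with (A := (qcoef_max * 2)%R). intro n.
    rewrite Cmod_opp. replace (qcoef_max * 2 * r ^ n)%R with (qcoef_max * r ^ n * 2)%R by ring.
    apply Cmod_mult_le; [now apply Phi_dom; try apply Cmod_1_le|].
    apply Cmod_one_minus_le. rewrite <- Cpow_add_r. apply Cmod_q_pow_le_1.
  - simpl. ring.
Qed.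

Lemma CSeries_Cmod_le (a : nat -> C) (b : nat -> R) :
  dominated a b -> (Cmod (CSeries a) <= Series b)%R.
Proof.
  intro D. pose proof (CSeries_tail a b O D) as H. rewrite !sum_O in H.
  pose proof (proj2 D O). pose proof (Cmod_triangle_inv (CSeries a) (a O)). lra.
Qed.

Lemma qcoef_cont (w : nat -> C) (w0 : C) (n : nat) :
  (forall j, (Cmod (w j) <= 1)%R) -> Clim w w0 ->
  Clim (fun j => qcoef (w j) n) (qcoef w0 n).
Proof.
  intros Hw H. induction n as [|n IH]; [apply Clim_const|].
  apply Clim_mult; [exact IH|]. apply Clim_mult.
  - apply Clim_minus; [apply Clim_const|]. apply Clim_mult; [exact H | apply Clim_const].
  - apply Clim_inv with (d := (1 - r)%R); [lra| |].
    + intro j. apply one_minus_bound, wq_pow_le; [apply Hw | lia].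
    + apply Clim_minus; [apply Clim_const|]. apply Clim_mult; [exact H | apply Clim_const].
Qed.

Lemma Phi_cont (w t : nat -> C) (w0 t0 : C) :
  (forall j, (Cmod (w j) <= 1)%R) -> (forall j, (Cmod (t j) <= r)%R) ->
  Clim w w0 -> Clim t t0 -> Clim (fun j => Phi (w j) (t j)) (Phi w0 t0).
Proof.
  intros Hw Ht Lw Lt.
  apply (tannery (fun j k => qcoef (w j) k * t j ^ k) _ (fun n => qcoef_max * r ^ n)%R).
  - intro j. apply Phi_dom; auto.
  - intro k. apply Clim_mult; [now apply qcoef_cont | now apply Clim_pow].
Qed.

Lemma Phi_0 (w : C) : Phi w 0 = 1.
Proof.
  apply is_CSeries_unique.
  (* [g] jumps from 0 to 1 after index 0, so its differences are the constant term 1 followed by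
     zeros. *)
  apply is_series_telescope
    with (g := fun n => match n with O => RtoC 0 | S _ => RtoC 1 end) (l := RtoC 1).
  - intros [|n].
    + change (1 * 1 = 1 - 0). ring.
    + rewrite Cpow_S. ring.
  - apply Clim_incr, Clim_const.
  - ring.
Qed.

Lemma q_pow_lim : Clim (fun n => q ^ n) 0.
Proof.
  apply geom_lim0 with (A := 1%R). intro n. rewrite Rmult_1_l. now apply Cmod_pow_le.
Qed.

(** Induction on [n]: [Phi_1_step] at [t = w q^(2n+1)] multiplies by exactly the factor of index [n]
    of [qcoef w]. *)
Lemma qcoef_mult_U (w : C) (n : nat) : (Cmod w <= 1)%R ->
  qcoef w n * Phi 1 (w * q) = Phi 1 (w * (q ^ n * q ^ n * q)).
Proof.
  intro Hw. induction n as [|n IH].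
  - replace (w * (q ^ 0 * q ^ 0 * q)) with (w * q)
      by (change (q ^ 0) with (RtoC 1); ring).
    apply Cmult_1_l.
  - rewrite qcoef_S.
    pose proof (Phi_1_step (w * (q ^ n * q ^ n * q))) as H.
    pose proof (qcoef_den_nz w n Hw) as nz.
    assert (Hb : (Cmod (w * (q ^ n * q ^ n * q)) <= r)%R).
    { replace (q ^ n * q ^ n * q) with (q ^ (n + n + 1))
        by (rewrite !Cpow_add_r, Cpow_1_r; reflexivity).
      apply wq_pow_le; [exact Hw | lia]. }
    specialize (H Hb). rewrite <- IH in H.
    replace (w * (q ^ S n * q ^ S n * q)) with (w * (q ^ n * q ^ n * q) * (q * q))
      by (simpl; ring).
    transitivity ((1 - w * (q ^ n * q ^ n * q)) * (qcoef w n * Phi 1 (w * q))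
      / (1 - w * (q ^ n * q ^ n * (q * q)))); [field; exact nz|].
    rewrite H. field. exact nz.
Qed.

(* By the [q]-binomial theorem [Phi 1 (w q)] is the reciprocal of the infinite
   product [lim (qcoef w)]; the functional equation yields this without evaluating
   either side. *)
Lemma qcoef_lim (w : C) : (Cmod w <= 1)%R ->
  exists e, Clim (qcoef w) e /\ e * Phi 1 (w * q) = 1.
Proof.
  intro Hw.
  destruct (cprod_cv (qcoef_factor w) _ r r01 (fun j => qcoef_factor_bound w j Hw)) as [e He].
  exists e; split; [exact He|].
  apply (Clim_unique (fun n => qcoef w n * Phi 1 (w * q))).
  - apply Clim_mult; [exact He | apply Clim_const].
  - apply Clim_ext with (u := fun n => Phi 1 (w * (q ^ n * q ^ n * q))).
    { intro n; symmetry; now apply qcoef_mult_U. }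
    pose proof (Phi_cont (fun _ => 1) (fun n => w * (q ^ n * q ^ n * q)) 1 0) as H.
    rewrite Phi_0 in H. apply H.
    + intro; apply Cmod_1_le.
    + intro n. replace (q ^ n * q ^ n * q) with (q ^ (n + n + 1))
        by (rewrite !Cpow_add_r, Cpow_1_r; reflexivity).
      apply wq_pow_le; [exact Hw | lia].
    + apply Clim_const.
    + replace (RtoC 0) with (w * (0 * 0 * q)) by ring.
      apply Clim_mult; [apply Clim_const|].
      apply Clim_mult; [|apply Clim_const].
      apply Clim_mult; apply q_pow_lim.
Qed.

(** * The theta series as a value of [Phi] *)

Lemma Cmod_q2_mult_le (w : C) : (Cmod w <= 1)%R -> (Cmod (w * (q * q)) <= 1)%R.
Proof.
  intro Hw. rewrite <- (Rmult_1_l 1). apply Cmod_mult_le; [exact Hw|].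
  pose proof (Cmod_q_pow_le_1 2) as H; simpl in H. now rewrite Cmult_1_r in H.
Qed.

Lemma wq_le (w : C) : (Cmod w <= 1)%R -> (Cmod (w * q) <= r)%R.
Proof. intro Hw. now apply Cmod_mult_r. Qed.

(** Replacing [w] by [w q^2] shifts numerator and denominator products by one index, so only end
    factors change; the quotient is stated with denominators cleared. *)
Lemma qcoef_shift (w : C) (n : nat) : (Cmod w <= 1)%R ->
  qcoef (w * (q * q)) n * ((1 - w * q) * (1 - w * (q ^ n * q ^ n * (q * q)) ))
  = qcoef w n * ((1 - w * (q ^ n * q ^ n * q)) * (1 - w * (q * q))).
Proof.
  intro Hw. induction n as [|n IH].
  - change (qcoef (w * (q * q)) 0) with (RtoC 1). change (qcoef w 0) with (RtoC 1). simpl. ring.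
  - rewrite !qcoef_S.
    pose proof (qcoef_den_nz w n Hw) as nz.
    pose proof (qcoef_den_nz _ n (Cmod_q2_mult_le _ Hw)) as nz2.
    replace (w * (q ^ S n * q ^ S n * (q * q))) with (w * (q * q) * (q ^ n * q ^ n * (q * q)))
      by (simpl; ring).
    replace (w * (q ^ S n * q ^ S n * q)) with (w * (q * q) * (q ^ n * q ^ n * q))
      by (simpl; ring).
    set (X1 := 1 - w * (q * q) * (q ^ n * q ^ n * q)).
    set (X2 := 1 - w * (q * q) * (q ^ n * q ^ n * (q * q))) in *.
    set (Y2 := 1 - w * (q ^ n * q ^ n * (q * q))) in *.
    transitivity (qcoef (w * (q * q)) n * ((1 - w * q) * Y2) * (X1 / Y2)); [field; auto|].
    rewrite IH. field. exact nz.
Qed.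

(** One step of the Rogers-Fine recursion: it splits off the first two terms of the theta series,
    and [w^2 q^3], the third, multiplies the rest. *)
Lemma Phi_theta_step (w : C) : (Cmod w <= 1)%R ->
  Phi w (w * q) = 1 + w * q + w * w * (q * q * q) * Phi (w * (q * q)) (w * (q * q) * q).
Proof.
  intro Hw. pose proof (Cmod_q2_mult_le w Hw) as Hw2.
  pose proof (CSeries_lin 1 (- (w * w * (q * q * q))) _ _ _ _
    (Phi_dom w _ Hw (wq_le w Hw)) (Phi_dom _ _ Hw2 (wq_le _ Hw2))) as H.
  apply is_CSeries_unique in H.
  change (CSeries (fun n => qcoef w n * (w * q) ^ n)) with (Phi w (w * q)) in H.
  change (CSeries (fun n => qcoef (w * (q * q)) n * (w * (q * q) * q) ^ n))
    with (Phi (w * (q * q)) (w * (q * q) * q)) in H.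
  assert (nx : 1 - w * q <> 0) by now apply one_minus_nz, wq_le.
  assert (E : 1 * Phi w (w * q) + - (w * w * (q * q * q)) * Phi (w * (q * q)) (w * (q * q) * q)
    = 1 + w * q).
  { rewrite <- H. apply is_CSeries_unique.
    (* At index 0 the certificate is [(w^2 q^2 - 1) / (1 - w q) = - (1 + w q)], and its limit is 0;
       this leaves [1 + w q]. *)
    apply is_series_telescope with (l := RtoC 0) (g := fun n =>
      qcoef w n * (w * q) ^ n * ((- (1) + w * q * (w * q) * (q ^ n * q ^ n)) / (1 - w * q))).
    - intro n. pose proof (qcoef_den_nz w n Hw) as nz.
      replace (qcoef (w * (q * q)) n) with
        (qcoef w n * ((1 - w * (q ^ n * q ^ n * q)) * (1 - w * (q * q)))
          / ((1 - w * q) * (1 - w * (q ^ n * q ^ n * (q * q))))).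
      2:{ rewrite <- qcoef_shift by exact Hw. field. auto. }
      rewrite qcoef_S, !Cpow_mult_l. simpl Cpow. field. auto.
    - apply geom_lim0 with (A := (qcoef_max * (2 * / (1 - r)))%R). intro n.
      replace (qcoef_max * (2 * / (1 - r)) * r ^ n)%R
        with (qcoef_max * r ^ n * (2 * / (1 - r)))%R by ring.
      apply Cmod_mult_le.
      + apply Phi_dom; [exact Hw | now apply wq_le].
      + apply Cmod_mult_le.
        * replace (- (1) + w * q * (w * q) * (q ^ n * q ^ n))
            with (- (1 - w * w * q ^ (n + n + 2)))
            by (rewrite !Cpow_add_r; simpl; ring).
          rewrite Cmod_opp. apply Cmod_one_minus_le. rewrite <- (Rmult_1_l 1).
          apply Cmod_mult_le; [|apply Cmod_q_pow_le_1].
          rewrite <- (Rmult_1_l 1). now apply Cmod_mult_le.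
        * rewrite Cmod_inv by exact nx. apply Rinv_le_contravar; [lra|].
          now apply one_minus_bound, wq_le.
    - change (qcoef w 0) with (RtoC 1). simpl. field. exact nx. }
  rewrite <- E. ring.
Qed.

(** Written with [Nat.div] to be convertible to the exponent in the theorem; the recursion comes
    from [tri_S]. *)
Definition tri (n : nat) : nat := Nat.div (n * (n + 1)) 2.

Lemma tri_S (n : nat) : tri (S n) = (tri n + S n)%nat.
Proof.
  unfold tri. replace (S n * (S n + 1))%nat with (n * (n + 1) + S n * 2)%nat by lia.
  now rewrite Nat.div_add by lia.
Qed.

Lemma tri_ge (n : nat) : (n <= tri n)%nat.
Proof. induction n as [|n IH]; [lia | rewrite tri_S; lia]. Qed.

Lemma r_pow_decr (m n : nat) : (m <= n)%nat -> (r ^ n <= r ^ m)%R.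
Proof.
  intro H. replace n with (m + (n - m))%nat by lia. rewrite pow_add.
  pose proof (r_pow_pos m). pose proof (r_pow_le_1 (n - m)). nra.
Qed.

Lemma Cmod_q_tri (n : nat) : (Cmod (q ^ tri n) <= r ^ n)%R.
Proof. eapply Rle_trans; [now apply Cmod_pow_le | apply r_pow_decr, tri_ge]. Qed.

Lemma Cmod_pow_le_1 (w : C) (n : nat) : (Cmod w <= 1)%R -> (Cmod (w ^ n) <= 1)%R.
Proof.
  intro Hw. rewrite Cmod_pow, <- (pow1 n). apply pow_incr.
  split; [apply Cmod_ge_0 | exact Hw].
Qed.

Lemma theta_dom (w : C) : (Cmod w <= 1)%R ->
  dominated (fun n => w ^ n * q ^ tri n) (fun n => 1 * r ^ n)%R.
Proof.
  intro Hw. split; [now apply ex_series_geom_scal|].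
  intro n. apply Cmod_mult_le; [now apply Cmod_pow_le_1 | apply Cmod_q_tri].
Qed.

(** Each use of [Phi_theta_step], at [w q^m] with [m] even, releases the terms of index [m] and
    [m + 1]; hence the odd upper index of the sum. *)
Lemma Phi_theta_partial (w : C) (n : nat) : (Cmod w <= 1)%R ->
  Phi w (w * q) = sum_n (fun k => w ^ k * q ^ tri k) (2 * n + 1)
    + w ^ (2 * n + 2) * q ^ tri (2 * n + 2)
      * Phi (w * q ^ (2 * n + 2)) (w * q ^ (2 * n + 2) * q).
Proof.
  intro Hw. induction n as [|n IH].
  - rewrite Phi_theta_step by exact Hw.
    change (2 * 0 + 1)%nat with 1%nat. rewrite sum_Sn, sum_O. unfold plus; simpl.
    change (tri 0) with 0%nat. change (tri 1) with 1%nat. change (tri 2) with 3%nat.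
    replace (q * (q * 1)) with (q * q) by ring. simpl Cpow. ring.
  - rewrite IH, Phi_theta_step.
    2:{ rewrite <- (Rmult_1_l 1). apply Cmod_mult_le; [exact Hw | apply Cmod_q_pow_le_1]. }
    replace (2 * S n + 1)%nat with (S (S (2 * n + 1))) by lia.
    replace (2 * S n + 2)%nat with (S (S (S (2 * n + 1)))) by lia.
    replace (2 * n + 2)%nat with (S (2 * n + 1)) by lia.
    rewrite !sum_Sn.
    set (P := sum_n _ (2 * n + 1)). clearbody P. clear IH.
    generalize (S (2 * n + 1)) as m. intro m. rewrite !tri_S.
    replace (w * q ^ m * (q * q)) with (w * q ^ S (S m)) by (simpl; ring).
    set (Y := Phi _ _).
    replace (tri m + S m + S (S m))%nat with (tri m + m + m + 3)%nat by lia.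
    replace (tri m + S m)%nat with (tri m + m + 1)%nat by lia.
    rewrite !Cpow_add_r, !(Cpow_S w).
    unfold plus; cbn [AbelianMonoid.plus AbelianMonoid.class C_AbelianMonoid].
    replace (q ^ 3) with (q * q * q) by (simpl; ring). rewrite Cpow_1_r.
    change (@eq C (P + w ^ m * q ^ tri m * (1 + w * q ^ m * q
        + w * q ^ m * (w * q ^ m) * (q * q * q) * Y))
      (P + w ^ m * q ^ tri m + w * w ^ m * (q ^ tri m * q ^ m * q)
        + w * (w * w ^ m) * (q ^ tri m * q ^ m * q ^ m * (q * q * q)) * Y)).
    ring.
Qed.

Lemma Phi_theta (w : C) : (Cmod w <= 1)%R ->
  Phi w (w * q) = CSeries (fun n => w ^ n * q ^ tri n).
Proof.
  intro Hw. set (S1 := fun k => w ^ k * q ^ tri k).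
  apply (Clim_unique (fun n => sum_n S1 (2 * n + 1))).
  - apply Clim_ext with (u := fun n => Phi w (w * q) - (w ^ (2 * n + 2) * q ^ tri (2 * n + 2)
      * Phi (w * q ^ (2 * n + 2)) (w * q ^ (2 * n + 2) * q))).
    { intro n. rewrite (Phi_theta_partial w n Hw). fold S1. ring. }
    replace (Phi w (w * q)) with (Phi w (w * q) - 0) at 1 by ring.
    apply Clim_minus; [apply Clim_const|].
    (* The remainder is at most [r^n], because [tri m >= m], times a bound for [Phi] that is uniform
       in its arguments. *)
    apply geom_lim0 with (A := Series (fun n => qcoef_max * r ^ n)%R). intro n.
    rewrite Rmult_comm. apply Cmod_mult_le.
    + rewrite <- (Rmult_1_l (r ^ n)). apply Cmod_mult_le; [now apply Cmod_pow_le_1|].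
      eapply Rle_trans; [apply Cmod_q_tri | apply r_pow_decr; lia].
    + assert (Hw' : (Cmod (w * q ^ (2 * n + 2)) <= 1)%R).
      { rewrite <- (Rmult_1_l 1). apply Cmod_mult_le; [exact Hw | apply Cmod_q_pow_le_1]. }
      apply CSeries_Cmod_le, Phi_dom; [exact Hw' | now apply wq_le].
  (* Partial sums with odd upper index determine the sum, since the whole series converges by
     [theta_dom]. *)
  - apply (Clim_subseq (sum_n S1) _ (fun n => 2 * n + 1)%nat); [intro; lia|].
    exact (CSeries_correct _ _ (theta_dom w Hw)).
Qed.

(** * The series [Gam] and its functional equation *)

(** A lower bound uniform in [n], rather than mere nonvanishing, gives [Gam] a majorant independent
    of [z]. *)
Definition off_poles (z : C) : Prop := forall n, (1 - r <= Cmod (1 + z * q ^ n))%R.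

Lemma off_poles_nz (z : C) (n : nat) : off_poles z -> 1 + z * q ^ n <> 0.
Proof. intros H E. specialize (H n). rewrite E, Cmod_0 in H. lra. Qed.

Lemma off_poles_mult_q (z : C) : off_poles z -> off_poles (z * q).
Proof. intros H n. specialize (H (S n)). now rewrite Cpow_S, Cmult_assoc in H. Qed.

(** For [n = 0] the denominator is [1 + x >= 1], by the sign of [x]; for [n >= 1] already
    [|x q^n| <= r]. *)
Lemma off_poles_unit_interval (x : R) : (0 <= x <= 1)%R -> off_poles (RtoC x).
Proof.
  intros Hx [|n].
  - change (q ^ 0) with (RtoC 1). rewrite Cmult_1_r, <- RtoC_plus, Cmod_R, Rabs_pos_eq; lra.
  - replace (1 + x * q ^ S n) with (1 - (- x) * q ^ S n) by ring.
    apply one_minus_bound, wq_pow_le; [|lia].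
    rewrite Cmod_opp, Cmod_R, Rabs_pos_eq; lra.
Qed.

Definition Gam (z : C) : C := CSeries (fun n => q ^ n * qcoef 1 n / (1 + z * q ^ n)).

Lemma Gam_dom (z : C) : off_poles z ->
  dominated (fun n => q ^ n * qcoef 1 n / (1 + z * q ^ n))
    (fun n => qcoef_max * / (1 - r) * r ^ n)%R.
Proof.
  intro Hz. split; [now apply ex_series_geom_scal|].
  intro n. replace (qcoef_max * / (1 - r) * r ^ n)%R with (r ^ n * qcoef_max * / (1 - r))%R by ring.
  apply Cmod_mult_le.
  - apply Cmod_mult_le; [now apply Cmod_pow_le | apply qcoef_bound, Cmod_1_le].
  - rewrite Cmod_inv by now apply off_poles_nz. apply Rinv_le_contravar; [lra | apply Hz].
Qed.

Lemma Gam_cont (z : nat -> C) (z0 : C) :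
  (forall j, off_poles (z j)) -> Clim z z0 -> Clim (fun j => Gam (z j)) (Gam z0).
Proof.
  intros Hz L.
  apply (tannery (fun j n => q ^ n * qcoef 1 n / (1 + z j * q ^ n)) _
    (fun n => qcoef_max * / (1 - r) * r ^ n)%R).
  - intro j; now apply Gam_dom.
  - intro n. apply Clim_mult; [apply Clim_const|].
    apply Clim_inv with (d := (1 - r)%R); [lra | intro j; apply Hz|].
    apply Clim_plus; [apply Clim_const|]. apply Clim_mult; [exact L | apply Clim_const].
Qed.

Lemma Gam_0 : Gam 0 = Phi 1 q.
Proof.
  apply CSeries_ext. intro n. replace (1 + 0 * q ^ n) with (RtoC 1) by ring. field.
Qed.

Lemma Gam_step (z d : C) : (Cmod z <= 1)%R -> off_poles z -> Clim (qcoef 1) d ->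
  (1 - z * z) * Gam z = (1 - z * z * q) * Gam (z * q) - z * d.
Proof.
  intros Hz Az Hd.
  pose proof (CSeries_lin (1 - z * z) (- (1 - z * z * q)) _ _ _ _
    (Gam_dom z Az) (Gam_dom _ (off_poles_mult_q z Az))) as H.
  apply is_CSeries_unique in H.
  change (CSeries (fun n => q ^ n * qcoef 1 n / (1 + z * q ^ n))) with (Gam z) in H.
  change (CSeries (fun n => q ^ n * qcoef 1 n / (1 + z * q * q ^ n))) with (Gam (z * q)) in H.
  assert (E : (1 - z * z) * Gam z + - (1 - z * z * q) * Gam (z * q) = - z * d).
  { rewrite <- H. apply is_CSeries_unique.
    (* This certificate does not vanish at infinity: [q^n] tends to 0 and [qcoef 1 n] to [d], which
       leaves [- z * d]. At index 0 it is 0. *)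
    apply is_series_telescope with (l := - z * (d * (1 - 0 * 0) * / (1 + z * 0)))
      (g := fun n => - z * (qcoef 1 n * (1 - q ^ n * q ^ n) * / (1 + z * q ^ n))).
    - intro n. pose proof (qcoef_den_nz 1 n Cmod_1_le) as nz.
      pose proof (off_poles_nz z n Az) as n1. pose proof (off_poles_nz z (S n) Az) as n2.
      rewrite qcoef_S. simpl Cpow in *. set (y := q ^ n) in *. set (C0 := qcoef 1 n).
      field.
      repeat split; intro E;
        first [apply nz; rewrite <- E; ring | apply n1; rewrite <- E; ring
              | apply n2; rewrite <- E; ring].
    - apply Clim_mult; [apply Clim_const|]. apply Clim_mult.
      + apply Clim_mult; [exact Hd|]. apply Clim_minus; [apply Clim_const|].
        apply Clim_mult; apply q_pow_lim.
      + apply Clim_inv with (d := (1 - r)%R); [lra | exact Az|].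
        apply Clim_plus; [apply Clim_const|]. apply Clim_mult; [apply Clim_const | apply q_pow_lim].
    - change (q ^ 0) with (RtoC 1). pose proof (off_poles_nz z 0 Az) as n0.
      change (q ^ 0) with (RtoC 1) in n0. field.
      intro E; apply n0; rewrite <- E; ring. }
  replace ((1 - z * z) * Gam z) with
    ((1 - z * z) * Gam z + - (1 - z * z * q) * Gam (z * q) + (1 - z * z * q) * Gam (z * q)) by ring.
  rewrite E. ring.
Qed.

(** Multiplied by [c_k(w)] with [w = z^2], [Gam_step] at [z q^k] becomes a chain, because [c_k(w) (1
    - w q^(2k+1)) = c_{k+1}(w) (1 - w q^(2k+2))]. *)
Lemma Gam_iterate (z d : C) (n : nat) : (Cmod z <= 1)%R -> off_poles z -> Clim (qcoef 1) d ->
  (1 - z * z) * Gam z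
  = qcoef (z * z) (S n) * (1 - z * z * (q ^ S n * q ^ S n)) * Gam (z * q ^ S n)
    - z * d * sum_n (fun k => qcoef (z * z) k * q ^ k) n.
Proof.
  intros Hz Az Hd.
  assert (Hw : (Cmod (z * z) <= 1)%R).
  { rewrite <- (Rmult_1_l 1). now apply Cmod_mult_le. }
  assert (Step : forall k,
    qcoef (z * z) k * (1 - z * z * (q ^ k * q ^ k)) * Gam (z * q ^ k)
    = qcoef (z * z) (S k) * (1 - z * z * (q ^ S k * q ^ S k)) * Gam (z * q ^ S k)
      - z * d * (qcoef (z * z) k * q ^ k)).
  { intro k.
    assert (Ak : off_poles (z * q ^ k)).
    { induction k as [|k IH]; [now rewrite Cmult_1_r|].
      rewrite Cpow_S. replace (z * (q * q ^ k)) with (z * q ^ k * q) by ring.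
      now apply off_poles_mult_q. }
    assert (Hk : (Cmod (z * q ^ k) <= 1)%R).
    { rewrite <- (Rmult_1_l 1). apply Cmod_mult_le; [exact Hz | apply Cmod_q_pow_le_1]. }
    pose proof (Gam_step _ d Hk Ak Hd) as H.
    pose proof (qcoef_den_nz (z * z) k Hw) as nz.
    rewrite qcoef_S, Cpow_S.
    replace (z * (q * q ^ k)) with (z * q ^ k * q) by ring.
    transitivity (qcoef (z * z) k * ((1 - z * q ^ k * (z * q ^ k)) * Gam (z * q ^ k))); [ring|].
    rewrite H. field. exact nz. }
  induction n as [|n IH].
  - rewrite sum_O, <- Step. change (q ^ 0) with (RtoC 1). change (qcoef (z * z) 0) with (RtoC 1).
    replace (z * 1) with z by ring. ring.
  - rewrite IH, sum_Sn, Step. unfold plus; cbn [AbelianMonoid.plus].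
    set (P := sum_n _ n).
    set (X := qcoef (z * z) (S (S n)) * _ * _). set (Y := qcoef (z * z) (S n) * _).
    change (@eq C (X - z * d * Y - z * d * P) (X - z * d * (P + Y))). ring.
Qed.

(** Limit of [Gam_iterate], where [Gam (z q^n)] tends to [Gam 0 = Phi 1 q]. The limits [d] and [e]
    of [qcoef 1] and [qcoef (z * z)] are then absorbed by [d * psi = 1] and [e * K = 1]. *)
Lemma Gam_formula (z : C) : (Cmod z <= 1)%R -> off_poles z ->
  (1 - z * z) * (Phi 1 q * Phi 1 (z * z * q) * Gam z)
  = Phi 1 q * Phi 1 q - z * Phi (z * z) q * Phi 1 (z * z * q).
Proof.
  intros Hz Az.
  assert (Hw : (Cmod (z * z) <= 1)%R).
  { rewrite <- (Rmult_1_l 1). now apply Cmod_mult_le. }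
  destruct (qcoef_lim 1 Cmod_1_le) as [d [Hd Ed]]. rewrite Cmult_1_l in Ed.
  destruct (qcoef_lim (z * z) Hw) as [e [He Ee]].
  assert (E : (1 - z * z) * Gam z
    = e * (1 - z * z * (0 * 0)) * Phi 1 q - z * d * Phi (z * z) q).
  { apply (Clim_unique (fun _ => (1 - z * z) * Gam z)); [apply Clim_const|].
    eapply Clim_ext; [intro n; symmetry; now apply (Gam_iterate z d n)|].
    apply Clim_minus; [apply Clim_mult; [apply Clim_mult|]|].
    - now apply Clim_incr.
    - apply Clim_minus; [apply Clim_const|]. apply Clim_mult; [apply Clim_const|].
      apply Clim_mult; apply (Clim_incr (fun n => q ^ n)), q_pow_lim.
    - apply (Clim_incr (fun n => Gam (z * q ^ n))). rewrite <- Gam_0.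
      apply Gam_cont.
      + intros n k. replace (z * q ^ n * q ^ k) with (z * q ^ (n + k))
          by (rewrite Cpow_add_r; ring).
        apply Az.
      + replace (RtoC 0) with (z * 0) by ring.
        apply Clim_mult; [apply Clim_const | apply q_pow_lim].
    - apply Clim_mult; [apply Clim_const|].
      exact (CSeries_correct _ _ (Phi_dom (z * z) q Hw qr)). }
  set (psi := Phi 1 q) in *. set (K := Phi 1 (z * z * q)) in *.
  replace ((1 - z * z) * (psi * K * Gam z)) with (psi * K * ((1 - z * z) * Gam z)) by ring.
  rewrite E.
  replace (psi * K * (e * (1 - z * z * (0 * 0)) * psi - z * d * Phi (z * z) q))
    with (e * K * (psi * psi) - z * Phi (z * z) q * K * (d * psi)) by ring.
  rewrite Ee, Ed. ring.
Qed.

(** * Division by [1 - w] and the limit [z -> 1] *)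

(** The quotient [(1 - w^n) / (1 - w)] as a polynomial, so that it keeps a meaning, [n], at
    [w = 1]. *)
Fixpoint qnum (w : C) (n : nat) : C :=
  match n with
  | O => 0
  | S m => qnum w m + w ^ m
  end.

Lemma qnum_spec (w : C) (n : nat) : (1 - w) * qnum w n = 1 - w ^ n.
Proof.
  induction n as [|n IH].
  - change (qnum w 0) with (RtoC 0). change (w ^ 0) with (RtoC 1). ring.
  - change (qnum w (S n)) with (qnum w n + w ^ n).
    rewrite Cmult_plus_distr_l, IH, Cpow_S. ring.
Qed.

Lemma qnum_1 (n : nat) : qnum 1 n = INR n.
Proof.
  induction n as [|n IH]; [reflexivity|].
  change (qnum 1 (S n)) with (qnum 1 n + 1 ^ n).
  now rewrite IH, Cpow_1_l, S_INR, RtoC_plus.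
Qed.

Lemma qnum_bound (w : C) (n : nat) : (Cmod w <= 1)%R -> (Cmod (qnum w n) <= INR n)%R.
Proof.
  intro Hw. induction n as [|n IH].
  - change (qnum w 0) with (RtoC 0). rewrite Cmod_0. simpl; lra.
  - change (qnum w (S n)) with (qnum w n + w ^ n). rewrite S_INR.
    eapply Rle_trans; [apply Cmod_triangle|].
    pose proof (Cmod_pow_le_1 w n Hw). lra.
Qed.

Lemma qnum_cont (w : nat -> C) (w0 : C) (n : nat) :
  Clim w w0 -> Clim (fun j => qnum (w j) n) (qnum w0 n).
Proof.
  intro H. induction n as [|n IH]; [apply Clim_const|].
  apply Clim_plus; [exact IH | now apply Clim_pow].
Qed.

(** The difference quotient [(Phi w q - Phi w (v q)) / (1 - v)], continued to [v = 1]. *)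
Definition DPhi (w v : C) : C := CSeries (fun n => qcoef w n * q ^ n * qnum v n).

(** The difference quotient of the theta series between 1 and [w], continued to [w = 1], where it is
    the right-hand side of the theorem. *)
Definition DTheta (w : C) : C := CSeries (fun n => q ^ tri n * qnum w n).

Lemma DPhi_dom (w v : C) : (Cmod w <= 1)%R -> (Cmod v <= 1)%R ->
  dominated (fun n => qcoef w n * q ^ n * qnum v n) (fun n => qcoef_max * (INR n * r ^ n))%R.
Proof.
  intros Hw Hv. split.
  - apply (ex_series_scal (V := R_NormedModule)), ex_series_INR_geom, r01.
  - intro n. replace (qcoef_max * (INR n * r ^ n))%R with (qcoef_max * r ^ n * INR n)%R by ring.
    apply Cmod_mult_le; [now apply Phi_dom | now apply qnum_bound].
Qed.

Lemma DTheta_dom (w : C) : (Cmod w <= 1)%R ->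
  dominated (fun n => q ^ tri n * qnum w n) (fun n => INR n * r ^ n)%R.
Proof.
  intro Hw. split; [apply ex_series_INR_geom, r01|].
  intro n. rewrite Rmult_comm.
  apply Cmod_mult_le; [apply Cmod_q_tri | now apply qnum_bound].
Qed.

Lemma DPhi_spec (w v : C) : (Cmod w <= 1)%R -> (Cmod v <= 1)%R ->
  (1 - v) * DPhi w v = Phi w q - Phi w (v * q).
Proof.
  intros Hw Hv.
  pose proof (CSeries_lin 1 (- (1)) _ _ _ _
    (Phi_dom w q Hw qr) (Phi_dom w _ Hw (wq_le v Hv))) as H.
  apply is_CSeries_unique in H.
  replace (Phi w q - Phi w (v * q)) with (1 * Phi w q + - (1) * Phi w (v * q)) by ring.
  unfold Phi. rewrite <- H. symmetry. apply is_CSeries_unique.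
  apply is_series_ext with (fun n => (1 - v) * (qcoef w n * q ^ n * qnum v n)).
  - intro n. ceq. rewrite Cpow_mult_l.
    transitivity (qcoef w n * q ^ n * ((1 - v) * qnum v n)); [ring|].
    rewrite qnum_spec. ring.
  - apply (is_series_scal (V := C_NormedModule)).
    exact (CSeries_correct _ _ (DPhi_dom w v Hw Hv)).
Qed.

Lemma DTheta_spec (w : C) : (Cmod w <= 1)%R -> (1 - w) * DTheta w = Phi 1 q - Phi w (w * q).
Proof.
  intro Hw.
  pose proof (CSeries_lin 1 (- (1)) _ _ _ _ (theta_dom 1 Cmod_1_le) (theta_dom w Hw)) as H.
  apply is_CSeries_unique in H. rewrite <- !Phi_theta in H by (assumption || apply Cmod_1_le).
  rewrite (Cmult_1_l q) in H.
  replace (Phi 1 q - Phi w (w * q)) with (1 * Phi 1 q + - (1) * Phi w (w * q)) by ring.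
  rewrite <- H. symmetry. apply is_CSeries_unique.
  apply is_series_ext with (fun n => (1 - w) * (q ^ tri n * qnum w n)).
  - intro n. ceq. rewrite Cpow_1_l.
    transitivity (q ^ tri n * ((1 - w) * qnum w n)); [ring|].
    rewrite qnum_spec. ring.
  - apply (is_series_scal (V := C_NormedModule)).
    exact (CSeries_correct _ _ (DTheta_dom w Hw)).
Qed.

(** With [psi], [K], [F] as set in the proof and [w = z^2], [Gam_formula] is rewritten by
    [psi = K + (1 - w) V1] and [F = psi - (1 - w) W1 + (1 - w) V2]. What lacks the factor [1 - w]
    collapses to [(1 - z) psi K], and cancelling [1 - z] removes the degeneracy at [z = 1]. *)
Lemma Gam_reduced (z : C) : (Cmod z <= 1)%R -> off_poles z -> 1 - z * z <> 0 ->
  (1 + z) * (Phi 1 q * Phi 1 (z * z * q) * Gam z - Phi 1 q * DPhi 1 (z * z)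
    + z * Phi 1 (z * z * q) * DPhi (z * z) (z * z) - z * Phi 1 (z * z * q) * DTheta (z * z))
  = Phi 1 q * Phi 1 (z * z * q).
Proof.
  intros Hz Az nz.
  assert (Hw : (Cmod (z * z) <= 1)%R).
  { rewrite <- (Rmult_1_l 1). now apply Cmod_mult_le. }
  pose proof (Gam_formula z Hz Az) as HG.
  pose proof (DPhi_spec 1 (z * z) Cmod_1_le Hw) as HV.
  pose proof (DPhi_spec _ _ Hw Hw) as HV'.
  pose proof (DTheta_spec _ Hw) as HW.
  set (psi := Phi 1 q) in *. set (K := Phi 1 (z * z * q)) in *.
  set (V1 := DPhi 1 (z * z)) in *. set (V2 := DPhi (z * z) (z * z)) in *.
  set (W1 := DTheta (z * z)) in *. set (F := Phi (z * z) q) in *.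
  set (R := Phi (z * z) (z * z * q)) in *. set (G1 := Gam z) in *.
  assert (E : (1 - z * z) * (psi * K * G1 - psi * V1 + z * K * V2 - z * K * W1)
    = (1 - z) * (psi * K)).
  { transitivity ((1 - z * z) * (psi * K * G1) - psi * ((1 - z * z) * V1)
      + z * K * ((1 - z * z) * V2) - z * K * ((1 - z * z) * W1)); [ring|].
    rewrite HG, HV, HV', HW. ring. }
  assert (n1 : 1 - z <> 0).
  { intro E1. apply nz. replace (1 - z * z) with ((1 - z) * (1 + z)) by ring.
    rewrite E1. ring. }
  set (X := psi * K * G1 - psi * V1 + z * K * V2 - z * K * W1) in *.
  transitivity ((1 - z * z) * X / (1 - z)); [field; exact n1|].
  rewrite E. field. exact n1.
Qed.

Lemma Gam_1_eq : 2 * (Phi 1 q * Gam 1 - DTheta 1) = Phi 1 q.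
Proof.
  (* Real points strictly between 0 and 1: the shift by two keeps them positive, so [off_poles]
     holds and [1 - z^2] is nonzero. *)
  set (z := fun j => RtoC (1 - / INR (S (S j)))).
  assert (Hj : forall j, (0 < / INR (S (S j)) < 1)%R).
  { intro j. assert (1 < INR (S (S j)))%R by (apply lt_1_INR; lia).
    split; [apply Rinv_0_lt_compat; lra|]. rewrite <- Rinv_1. apply Rinv_lt_contravar; lra. }
  assert (Hz : forall j, (Cmod (z j) <= 1)%R).
  { intro j. unfold z. rewrite Cmod_R. specialize (Hj j). rewrite Rabs_pos_eq; lra. }
  assert (Hw : forall j, (Cmod (z j * z j) <= 1)%R).
  { intro j. rewrite <- (Rmult_1_l 1). now apply Cmod_mult_le. }
  assert (Az : forall j, off_poles (z j)).
  { intro j. apply off_poles_unit_interval. specialize (Hj j). lra. }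
  assert (Nz : forall j, 1 - z j * z j <> 0).
  { intro j. unfold z. rewrite <- RtoC_mult, <- RtoC_minus. intro E.
    apply (f_equal Re) in E. cbn [Re fst RtoC] in E. specialize (Hj j). nra. }
  assert (Lz : Clim z 1).
  { apply Clim_le with (b := fun j => (/ INR (S (S j)))%R).
    - intro j. unfold z. rewrite <- RtoC_minus, Cmod_R. specialize (Hj j).
      rewrite Rabs_left1; lra.
    - apply (is_lim_seq_inv (fun j => INR (S (S j))) p_infty); [|discriminate].
      apply (is_lim_seq_incr_1 (fun j => INR (S j)) p_infty).
      apply (is_lim_seq_incr_1 INR p_infty), is_lim_seq_INR. }
  assert (Lw : Clim (fun j => z j * z j) 1).
  { rewrite <- (Cmult_1_l 1). now apply Clim_mult. }
  assert (LK : Clim (fun j => Phi 1 (z j * z j * q)) (Phi 1 q)).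
  { apply (Phi_cont (fun _ => 1) (fun j => z j * z j * q)).
    - intro; apply Cmod_1_le.
    - intro; now apply wq_le.
    - apply Clim_const.
    - assert (L := Clim_mult _ _ _ _ Lw (Clim_const q)). rewrite Cmult_1_l in L. exact L. }
  assert (LV1 : Clim (fun j => DPhi 1 (z j * z j)) (DPhi 1 1)).
  { apply (tannery (fun j n => qcoef 1 n * q ^ n * qnum (z j * z j) n) _
      (fun n => qcoef_max * (INR n * r ^ n))%R).
    - intro j. apply DPhi_dom; [apply Cmod_1_le | apply Hw].
    - intro n. apply Clim_mult; [apply Clim_const | now apply (qnum_cont (fun j => z j * z j))]. }
  assert (LV2 : Clim (fun j => DPhi (z j * z j) (z j * z j)) (DPhi 1 1)).
  { apply (tannery (fun j n => qcoef (z j * z j) n * q ^ n * qnum (z j * z j) n) _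
      (fun n => qcoef_max * (INR n * r ^ n))%R).
    - intro j. now apply DPhi_dom.
    - intro n. apply Clim_mult; [|now apply (qnum_cont (fun j => z j * z j))].
      apply Clim_mult; [now apply (qcoef_cont (fun j => z j * z j)) | apply Clim_const]. }
  assert (LW : Clim (fun j => DTheta (z j * z j)) (DTheta 1)).
  { apply (tannery (fun j n => q ^ tri n * qnum (z j * z j) n) _
      (fun n => INR n * r ^ n)%R).
    - intro j. now apply DTheta_dom.
    - intro n. apply Clim_mult; [apply Clim_const | now apply (qnum_cont (fun j => z j * z j))]. }
  (* Limit of the left-hand side of [Gam_reduced]: [LV1] and [LV2] share the limit [DPhi 1 1], which
     enters with opposite signs. *)
  assert (L := Clim_mult _ _ _ _ (Clim_plus _ _ _ _ (Clim_const 1) Lz)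
    (Clim_minus _ _ _ _
      (Clim_plus _ _ _ _
        (Clim_minus _ _ _ _
          (Clim_mult _ _ _ _ (Clim_mult _ _ _ _ (Clim_const (Phi 1 q)) LK) (Gam_cont z 1 Az Lz))
          (Clim_mult _ _ _ _ (Clim_const (Phi 1 q)) LV1))
        (Clim_mult _ _ _ _ (Clim_mult _ _ _ _ Lz LK) LV2))
      (Clim_mult _ _ _ _ (Clim_mult _ _ _ _ Lz LK) LW))).
  assert (L' := Clim_mult _ _ _ _ (Clim_const (Phi 1 q)) LK).
  assert (E := Clim_unique _ _ _
    (Clim_ext _ _ _ (fun j => Gam_reduced (z j) (Hz j) (Az j) (Nz j)) L) L').
  destruct (qcoef_lim 1 Cmod_1_le) as [d [_ Ed]]. rewrite Cmult_1_l in Ed.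
  set (psi := Phi 1 q) in *.
  (* Multiplying by [d] cancels one factor [psi], as [d * psi = 1]. *)
  transitivity (d * psi * (2 * (psi * Gam 1 - DTheta 1))).
  - rewrite Ed. ring.
  - transitivity (d * ((1 + 1) * (psi * psi * Gam 1 - psi * DPhi 1 1 + 1 * psi * DPhi 1 1
      - 1 * psi * DTheta 1)));
      [ring|].
    rewrite E. transitivity (d * psi * psi); [ring|]. rewrite Ed. ring.
Qed.

(** * Infinite products and the summand *)

Lemma qpoch_cprod (a : C) (n : nat) : qpoch a q n = cprod (fun j => 1 - a * q ^ j) n.
Proof. induction n as [|n IH]; simpl; [|rewrite IH]; reflexivity. Qed.

Lemma qpoch_cv (a : C) : (Cmod a <= 1)%R -> Clim (qpoch a q) (qpoch_inf a q).
Proof.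
  intro Ha.
  destruct (cprod_cv (fun j => 1 - a * q ^ j) 1 r r01) as [l Hl].
  - intro j. replace (1 - a * q ^ j - 1) with (- (a * q ^ j)) by ring.
    rewrite Cmod_opp. apply Cmod_mult_le; [exact Ha | now apply Cmod_pow_le].
  - apply (Clim_ext _ (qpoch a q)) in Hl; [|intro; symmetry; apply qpoch_cprod].
    change (qpoch_inf a q) with (Climit (qpoch a q)).
    now rewrite (Climit_correct _ _ Hl).
Qed.

Lemma qpoch_nz (a : C) (n : nat) : (Cmod a <= r)%R -> qpoch a q n <> 0.
Proof.
  intro Ha. induction n as [|n IH]; simpl.
  - intro E. apply RtoC_inj in E. lra.
  - apply Cmult_neq_0; [exact IH|]. apply one_minus_nz. rewrite Cmult_comm.
    apply Cmod_mult_r; [apply Cmod_q_pow_le_1 | exact Ha].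
Qed.

(** The product of the inverse factors converges as well, and its limit is an inverse. *)
Lemma qpoch_inf_nz : qpoch_inf q q <> 0.
Proof.
  assert (Hq : forall j, (Cmod (q * q ^ j) <= r)%R) by (intro j; apply Cmod_q_pow_S).
  destruct (cprod_cv (fun j => / (1 - q * q ^ j)) (/ (1 - r)) r r01) as [l Hl].
  - intro j. pose proof (one_minus_nz _ (Hq j)) as nz.
    replace (/ (1 - q * q ^ j) - 1) with (/ (1 - q * q ^ j) * (q * q ^ j)) by (field; exact nz).
    apply Cmod_mult_le.
    + rewrite Cmod_inv by exact nz. apply Rinv_le_contravar; [lra|].
      now apply one_minus_bound.
    + rewrite <- (Rmult_1_l (r ^ j)). apply Cmod_mult_le; [lra | now apply Cmod_pow_le].
  - assert (Hq1 : (Cmod q <= 1)%R) by lra.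
    assert (E : l * qpoch_inf q q = 1).
    { refine (Clim_unique _ _ _ (Clim_mult _ _ _ _ Hl (qpoch_cv q Hq1)) _).
      apply Clim_ext with (u := fun _ => 1); [|apply Clim_const].
      induction n as [|n IH]; simpl; [ring|].
      pose proof (one_minus_nz _ (Hq n)) as nz.
      transitivity (cprod (fun j => / (1 - q * q ^ j)) n * qpoch q q n);
        [exact IH | field; exact nz]. }
    intro E0. rewrite E0, Cmult_0_r in E. apply RtoC_inj in E. lra.
Qed.

Lemma qpoch_shift (a : C) (n m : nat) :
  qpoch a q (n + m) = qpoch a q n * qpoch (a * q ^ n) q m.
Proof.
  induction m as [|m IH].
  - rewrite Nat.add_0_r. simpl. ring.
  - rewrite Nat.add_succ_r. simpl. rewrite IH, Cpow_add_r. ring.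
Qed.

Lemma qpoch_inf_shift (a : C) (n : nat) : (Cmod a <= r)%R ->
  qpoch_inf (a * q ^ n) q = qpoch_inf a q / qpoch a q n.
Proof.
  intro Ha. apply Climit_correct.
  apply Clim_ext with (u := fun m => qpoch a q (n + m) * / qpoch a q n).
  - intro m. rewrite qpoch_shift. field. now apply qpoch_nz.
  - apply Clim_mult; [|apply Clim_const].
    apply (Clim_subseq (qpoch a q) _ (fun m => n + m)%nat); [intro; lia|].
    apply qpoch_cv. lra.
Qed.

Lemma Cmod_opp_q : (Cmod (- q) <= r)%R.
Proof. now rewrite Cmod_opp. Qed.

(** Here [(q;q)_n (-q;q)_n = (q^2;q^2)_n], and [(q;q^2)_n (q^2;q^2)_n = (q;q)_{2n}]. Letting [n]
    grow evaluates the limit of [qcoef 1]. *)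
Lemma qcoef_1_qpoch (n : nat) :
  qcoef 1 n * (qpoch q q n * qpoch q q n * qpoch (- q) q n * qpoch (- q) q n)
  = qpoch q q (2 * n).
Proof.
  induction n as [|n IH].
  - change (1 * (1 * 1 * 1 * 1) = 1). ring.
  - replace (2 * S n)%nat with (S (S (2 * n))) by lia.
    cbn [qpoch]. rewrite <- IH, qcoef_S, Cpow_S, q_pow_double.
    pose proof (qcoef_den_nz 1 n Cmod_1_le) as nz. field.
    intro E; apply nz; rewrite <- E; ring.
Qed.

(* Gauss's product for the theta series, as [Phi 1 q = sum q^(n(n+1)/2)]. *)
Lemma Phi_1_q_product : Phi 1 q = qpoch_inf q q * qpoch_inf (- q) q ^ 2.
Proof.
  destruct (qcoef_lim 1 Cmod_1_le) as [d [Hd Ed]]. rewrite Cmult_1_l in Ed.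
  assert (LP : Clim (qpoch q q) (qpoch_inf q q)) by (apply qpoch_cv; lra).
  assert (LN : Clim (qpoch (- q) q) (qpoch_inf (- q) q))
    by (apply qpoch_cv; pose proof Cmod_opp_q; lra).
  assert (LP2 : Clim (fun n => qpoch q q (2 * n)) (qpoch_inf q q))
    by (apply (Clim_subseq (qpoch q q)); [intro; lia | exact LP]).
  assert (E := Clim_unique _ _ _
    (Clim_ext _ _ _ qcoef_1_qpoch
      (Clim_mult _ _ _ _ Hd (Clim_mult _ _ _ _ (Clim_mult _ _ _ _
        (Clim_mult _ _ _ _ LP LP) LN) LN)))
    LP2).
  pose proof qpoch_inf_nz as nz.
  set (P := qpoch_inf q q) in *. set (N := qpoch_inf (- q) q) in *.
  transitivity (Phi 1 q * P / P); [field; exact nz|].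
  rewrite <- E at 1.
  transitivity (d * Phi 1 q * (P * N ^ 2)); [field; exact nz|].
  rewrite Ed. ring.
Qed.

Lemma summand_spec (k : nat) :
  summand q (S k) = Phi 1 q * (q ^ S k * qcoef 1 (S k) / (1 + 1 * q ^ S k)).
Proof.
  rewrite Phi_1_q_product. unfold summand.
  replace (q ^ (S k + 1)) with (q * q ^ S k) by (rewrite Cpow_add_r, Cpow_1_r; ring).
  replace (- (q * q ^ S k)) with (- q * q ^ S k) by ring.
  rewrite (qpoch_inf_shift q) by exact qr.
  rewrite (qpoch_inf_shift (- q)) by exact Cmod_opp_q.
  pose proof (qpoch_nz q (S k) qr) as np.
  pose proof (qpoch_nz (- q) (S k) Cmod_opp_q) as nm.
  assert (n1 : 1 + 1 * q ^ S k <> 0).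
  { apply off_poles_nz, (off_poles_unit_interval 1). lra. }
  (* With [n = k + 1], [(q;q)_{2n}] splits as [(q;q)_k (q^n;q)_n (1 - q^(2n))], and
     [1 - q^(2n) = (1 - q^n)(1 + q^n)] completes [(q;q)_k] to [(q;q)_n]. *)
  assert (E : qcoef 1 (S k) * (qpoch q q (S k) * qpoch q q (S k)
      * qpoch (- q) q (S k) * qpoch (- q) q (S k))
    = qpoch (q ^ S k) q (S k) * qpoch q q (S k) * (1 + 1 * q ^ S k)).
  { rewrite qcoef_1_qpoch. replace (2 * S k)%nat with (S (k + S k)) by lia.
    change (qpoch q q (S (k + S k)))
      with (qpoch q q (k + S k) * (1 - q * q ^ (k + S k))).
    rewrite qpoch_shift, Cpow_add_r. rewrite <- Cpow_S.
    change (qpoch q q (S k)) with (qpoch q q k * (1 - q * q ^ k)).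
    rewrite <- Cpow_S.
    replace (q * (q ^ k * q ^ S k)) with (q ^ S k * q ^ S k) by (simpl; ring).
    ring. }
  set (X := qpoch (q ^ S k) q (S k)) in *. set (p := qpoch q q (S k)) in *.
  set (m := qpoch (- q) q (S k)) in *. set (y := q ^ S k) in *.
  set (P := qpoch_inf q q). set (N := qpoch_inf (- q) q). set (c1 := qcoef 1 (S k)) in *.
  transitivity (y * N ^ 2 * P * (X * p * (1 + 1 * y)) / (p * p * m * m * (1 + 1 * y)));
    [|rewrite <- E]; field; repeat split; auto;
    intro E0; apply n1; rewrite <- E0; ring.
Qed.

Lemma is_series1_summand : is_series1 (summand q) (DTheta 1).
Proof.
  assert (A1 : off_poles 1) by (apply (off_poles_unit_interval 1); lra).
  pose proof (CSeries_correct _ _ (Gam_dom 1 A1)) as H.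
  change (is_series (fun n => q ^ n * qcoef 1 n / (1 + 1 * q ^ n)) (Gam 1)) in H.
  apply (is_series_ext (V := C_NormedModule)
    (fun k => Phi 1 q * (q ^ S k * qcoef 1 (S k) / (1 + 1 * q ^ S k)))).
  { intro k; symmetry; apply summand_spec. }
  replace (DTheta 1) with (Phi 1 q * (Gam 1 - 1 / 2)).
  - apply (is_series_scal (V := C_NormedModule) (Phi 1 q)
      (fun k => q ^ S k * qcoef 1 (S k) / (1 + 1 * q ^ S k))).
    (* The subtracted [1 / 2] is the index 0 term of [Gam 1], absent from a sum that starts at 1. *)
    replace (Gam 1 - 1 / 2) with (Gam 1 - q ^ 0 * qcoef 1 0 / (1 + 1 * q ^ 0)).
    + exact (is_series_tail _ _ H).
    + change (Gam 1 - 1 * 1 / (1 + 1 * 1) = Gam 1 - 1 / 2). field.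
  - pose proof Gam_1_eq as E.
    transitivity ((2 * (Phi 1 q * Gam 1 - DTheta 1) + 2 * DTheta 1 - Phi 1 q) / 2); [field|].
    rewrite E. field.
Qed.

Lemma is_series_DTheta_1 : is_series (fun n => RtoC (INR n) * q ^ tri n) (DTheta 1).
Proof.
  apply (is_series_ext (V := C_NormedModule) (fun n => q ^ tri n * qnum 1 n)).
  - intro n. ceq. rewrite qnum_1. ring.
  - exact (CSeries_correct _ _ (DTheta_dom 1 Cmod_1_le)).
Qed.

(** * Integer coefficients *)

(* [tri_pos m = (n, k)] means [m = tri n + k] with [k <= n]. *)
Fixpoint tri_pos (m : nat) : nat * nat :=
  match m with
  | O => (O, O)
  | S m' => let (n, k) := tri_pos m' in
      if Nat.ltb k n then (n, S k) else (S n, O)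
  end.

Lemma tri_pos_spec (n k : nat) : (k <= n)%nat -> tri_pos (tri n + k) = (n, k).
Proof.
  revert k. induction n as [|n IHn].
  - intros k Hk. replace k with O by lia. reflexivity.
  - induction k as [|k IHk]; intro Hk.
    + rewrite tri_S. replace (tri n + S n + 0)%nat with (S (tri n + n)) by lia.
      simpl. rewrite IHn by lia. now rewrite Nat.ltb_irrefl.
    + rewrite Nat.add_succ_r. simpl. rewrite IHk by lia.
      now rewrite (proj2 (Nat.ltb_lt _ _)) by lia.
Qed.

Lemma tri_pos_le (m : nat) : (fst (tri_pos m) <= m)%nat.
Proof.
  induction m as [|m IH]; simpl; [lia|].
  destruct (tri_pos m) as [n k]; simpl in *. destruct (Nat.ltb k n); simpl; lia.
Qed.

(** A zero remainder marks the triangular numbers, so this is the coefficient of [q^m] in the sum of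
    the [n q^(tri n)]. *)
Definition A'' (m : nat) : Z :=
  match tri_pos m with (n, O) => Z.of_nat n | _ => 0%Z end.

(** Strictly between [tri n] and [tri (S n)] the coefficients vanish, so the partial sum is constant
    for [k <= n]. *)
Lemma A''_sum (n k : nat) : (k <= n)%nat ->
  sum_n (fun m => RtoC (IZR (A'' m)) * q ^ m) (tri n + k)
  = sum_n (fun m => RtoC (INR m) * q ^ tri m) n.
Proof.
  revert k. induction n as [|n IHn].
  - intros k Hk. replace k with O by lia.
    change (tri 0 + 0)%nat with O. rewrite !sum_O. reflexivity.
  - induction k as [|k IHk]; intro Hk.
    + replace (tri (S n) + 0)%nat with (S (tri n + n)) by (rewrite tri_S; lia).
      rewrite !sum_Sn, IHn by lia. f_equal.
      replace (S (tri n + n)) with (tri (S n) + 0)%nat by (rewrite tri_S; lia).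
      unfold A''. rewrite tri_pos_spec by lia.
      now rewrite <- INR_IZR_INZ, Nat.add_0_r.
    + rewrite Nat.add_succ_r, sum_Sn, IHk by lia.
      replace (S (tri (S n) + k)) with (tri (S n) + S k)%nat by lia.
      unfold A''. rewrite tri_pos_spec by lia.
      set (Sg := sum_n _ _).
      change (@eq C (Sg + 0 * q ^ (tri (S n) + S k)) Sg). ring.
Qed.

Lemma is_series_A'' : is_series (fun m => RtoC (IZR (A'' m)) * q ^ m) (DTheta 1).
Proof.
  assert (D : dominated (fun m => RtoC (IZR (A'' m)) * q ^ m) (fun m => INR m * r ^ m)%R).
  { split; [apply ex_series_INR_geom, r01|].
    intro m. apply Cmod_mult_le; [|now apply Cmod_pow_le].
    rewrite Cmod_R. pose proof (tri_pos_le m) as H. unfold A''.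
    destruct (tri_pos m) as [n [|k]]; simpl fst in H.
    - rewrite <- INR_IZR_INZ, Rabs_pos_eq by apply pos_INR. now apply le_INR.
    - rewrite Rabs_R0. apply pos_INR. }
  pose proof (CSeries_correct _ _ D) as H.
  replace (DTheta 1) with (CSeries (fun m => RtoC (IZR (A'' m)) * q ^ m)); [exact H|].
  (* Convergence is known from [A'' m <= m]; the sum is then identified along the subsequence of
     triangular indices. *)
  apply (Clim_unique (sum_n (fun m => RtoC (INR m) * q ^ tri m))).
  - apply Clim_ext with (u := fun n => sum_n (fun m => RtoC (IZR (A'' m)) * q ^ m) (tri n)).
    + intro n. rewrite <- (A''_sum n 0) by lia. now rewrite Nat.add_0_r.
    + apply (Clim_subseq _ _ tri tri_ge H).
  - exact is_series_DTheta_1.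
Qed.

End QSeries.

(** * Passage to arbitrary [q] and uniqueness of the coefficients *)

Lemma is_series1_of_is_series (a : nat -> C) (s : C) :
  a O = 0 -> is_series a s -> is_series1 a s.
Proof.
  intros a0 H. apply is_series_tail in H. rewrite a0 in H.
  replace s with (s - 0) by ring. exact H.
Qed.

(** The midpoint of [|q|] and 1 is positive even for [q = 0]. *)
Lemma exists_radius (q : C) : (Cmod q < 1)%R -> exists r, (0 < r < 1)%R /\ (Cmod q <= r)%R.
Proof.
  intro H. exists ((1 + Cmod q) / 2)%R. pose proof (Cmod_ge_0 q). lra.
Qed.

Lemma has_gf_A'' : has_gf A''.
Proof.
  intros q Hq. destruct (exists_radius q Hq) as [r [r01 qr]].
  exists (DTheta q 1). split.
  - apply is_series1_of_is_series; [apply Cmult_0_l|].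
    exact (is_series_A'' q r r01 qr).
  - exact (is_series1_summand q r r01 qr).
Qed.

Lemma is_series_Re (a : nat -> C) (s : C) :
  is_series a s -> is_series (fun n => Re (a n)) (Re s).
Proof.
  intro H. change (is_lim_seq (sum_n (fun n => Re (a n))) (Re s)).
  apply is_lim_seq_ext with (fun n => Re (sum_n a n)).
  - induction n as [|n IH]; [now rewrite !sum_O|].
    rewrite !sum_Sn, <- IH. reflexivity.
  - apply is_lim_seq_spec; intro eps.
    apply Clim_spec in H. destruct (proj2 (is_lim_seq_spec _ _) H eps) as [N HN].
    exists N; intros n Hn; specialize (HN n Hn).
    rewrite Rminus_0_r, Rabs_pos_eq in HN by apply Cmod_ge_0.
    apply Rle_lt_trans with (2 := HN).
    exact (re_le_Cmod (sum_n a n - s)).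
Qed.

(** The constant term is set to 0 because [has_gf] leaves [B 0] free. *)
Definition gf_coeff (B : nat -> Z) (n : nat) : R :=
  match n with O => 0%R | S _ => IZR (B n) end.

Lemma has_gf_pseries (B : nat -> Z) (x : R) : has_gf B -> (Rabs x < 1)%R ->
  exists s, is_series1 (summand x) s /\
    is_pseries (gf_coeff B) x (Re s).
Proof.
  intros HB Hx. rewrite <- Cmod_R in Hx.
  destruct (HB x Hx) as [s [Hs Hs']]. exists s. split; [exact Hs'|].
  apply is_series_Re in Hs.
  apply (is_series_decr_1 (V := R_NormedModule)).
  eapply is_series_ext; [|replace (plus _ _) with (Re s); [exact Hs|]].
  - intro n. cbv beta. rewrite pow_n_pow, <- RtoC_pow, re_scal_l.
    unfold scal; simpl. unfold mult; simpl. ring.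
  - unfold scal; simpl. unfold mult, plus, opp, one; simpl. ring.
Qed.

(** Outside the disk of convergence the terms cannot tend to 0, but at [1 / 2] they do; so the
    radius is at least [1 / 2]. *)
Lemma has_gf_radius (B : nat -> Z) : has_gf B ->
  Rbar_lt 0 (CV_radius (gf_coeff B)).
Proof.
  intro HB. destruct (has_gf_pseries B (1 / 2) HB) as [s [_ Hs]].
  { rewrite Rabs_pos_eq; lra. }
  apply Rbar_lt_le_trans with (1 / 2)%R; [simpl; lra|].
  apply Rbar_not_lt_le. intro H.
  apply (CV_disk_outside (gf_coeff B) (1 / 2)%R).
  - rewrite Rabs_pos_eq by lra. exact H.
  - assert (Hs' := ex_series_lim_0 _ (ex_intro _ _ Hs)).
    revert Hs'. apply is_lim_seq_ext.
    intro n. rewrite pow_n_pow. apply Rmult_comm.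
Qed.

(** At each real [x] with [|x| < 1] both power series equal the real part of the sum of the
    [summand] series. Power series of positive radius that agree near 0 have equal coefficients. *)
Lemma has_gf_unique (A B : nat -> Z) (n : nat) :
  has_gf A -> has_gf B -> (1 <= n)%nat -> B n = A n.
Proof.
  intros HA HB Hn.
  pose proof (PSeries_ext_recip _ _ n (has_gf_radius B HB) (has_gf_radius A HA)) as H.
  destruct n as [|n]; [lia|]. apply eq_IZR, H.
  exists (mkposreal 1 Rlt_0_1). intros x Hx.
  assert (Hx' : (Rabs x < 1)%R).
  { replace x with (minus x 0) by (unfold minus, plus, opp; simpl; ring). exact Hx. }
  destruct (has_gf_pseries A x HA Hx') as [s [Hs Ps]].
  destruct (has_gf_pseries B x HB Hx') as [s' [Hs' Ps']].
  rewrite (is_pseries_unique _ _ _ Ps), (is_pseries_unique _ _ _ Ps').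
  f_equal. exact (Clim_unique _ _ _ Hs' Hs).
Qed.

Theorem theorem1p3 :
  (exists A : nat -> Z,
      has_gf A /\
      forall B : nat -> Z, has_gf B ->
        forall n : nat, (1 <= n)%nat -> B n = A n) /\
  (forall q : C, (Cmod q < 1)%R ->
     exists s : C,
       is_series1 (summand q) s /\
       is_series1
         (fun n : nat => RtoC (INR n) * q ^ (Nat.div (n * (n + 1)) 2)) s).
Proof.
  split.
  - exists A''. split; [exact has_gf_A''|].
    intros B HB n Hn. exact (has_gf_unique A'' B n has_gf_A'' HB Hn).
  - intros q Hq. destruct (exists_radius q Hq) as [r [r01 qr]].
    exists (DTheta q 1). split.
    + exact (is_series1_summand q r r01 qr).
    + apply is_series1_of_is_series; [apply Cmult_0_l|].
      exact (is_series_DTheta_1 q r r01 qr).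
Qed.
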